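(* Consider the input-output system $$y_k=-\sum_{\tau=1}^nF_{\tau,k}\,y_{k-\tau}+\sum_{\tau=1}^nG_{\tau,k}\,u_{k-\tau}$$ with block-observable canonical form (BOCF) realization $x_{k+1}=A(x_k,u_k)x_k+B(x_k,u_k)u_k$, $y_k=Cx_k$, controlled by the iSCD-MPC algorithm applied to the BOCF state $x_k$ reconstructed from past inputs and outputs. (a) Suppose the following hypotheses hold for the BOCF realization: (A1), (A2), (A3), $Q$ positive definite, $0\in\mathrm{int}\,\mathcal X$, $0\in\mathrm{int}\,\mathcal U$, and at each step $k\in\mathbb N$ the applied sequence is a minimizer of ${\rm OCP}_k$, with $u_{k+1}$ equal to its first element. Then, for all initial extended states $z_0\in\mathcal F_\ell$, $\lim_{k\to\infty}y_k=0$. (b) Suppose instead the following hypotheses hold for the BOCF realization: (A1), (A2), (A3), $Q$ positive definite, $0\in\mathrm{int}\,\mathcal X$, $0\in\mathrm{int}\,\mathcal U$, the control is generated by the iSCD-MPC algorithm with its stopping criterion and warm start, for all $k\in\mathbb N$ the applied sequence $U_{k|\rho_k}$ is feasible for ${\rm OCP}_k$, and for all $k\ge1$, $\bar J_k(U_{k|\rho_k})\le\bar J_k(\mathcal S_{k-1}(U_{k-1|\rho_{k-1}}))$. Then, for all $z_0\in\mathcal F_\ell$ such that $U_{0|\rho_0}$ is feasible for ${\rm OCP}_0$, $\lim_{k\to\infty}y_k=0$.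
   Context: $\mathbb N=\{0,1,2,\ldots\}$; $\|\cdot\|$ is the Euclidean norm on vectors and the induced norm on matrices. Input-output system: $y_k\in\mathbb R^p$, $u_k\in\mathbb R^m$, $F_{\tau,k}=f_\tau(y_{k-1},\ldots,y_{k-n},u_{k-1},\ldots,u_{k-n})\in\mathbb R^{p\times p}$, $G_{\tau,k}=g_\tau(y_{k-1},\ldots,y_{k-n},u_{k-1},\ldots,u_{k-n})\in\mathbb R^{p\times m}$ for given functions $f_\tau,g_\tau$, $\tau\in\{1,\ldots,n\}$. BOCF realization: $x_k=(x_{k(1)},\ldots,x_{k(n)})\in\mathbb R^{np}$ with $x_{k(1)}=y_k$ and, for $\tau\in\{2,\ldots,n\}$, $x_{k(\tau)}=\sum_{s=1}^{n-\tau+1}(-F_{\tau+s-1,k}y_{k-s}+G_{\tau+s-1,k}u_{k-s})$. The realization is $x_{k+1}=A(x_k,u_k)x_k+B(x_k,u_k)u_k$, $y_k=Cx_k$, where $A(x_k,u_k)$ is the $n\times n$ block matrix (blocks $p\times p$) whose first block column is $(-F_{1,k+1},\ldots,-F_{n,k+1})$, whose $(\tau,\tau+1)$ blocks are $I_p$ for $\tau\in\{1,\ldots,n-1\}$, and whose other blocks are zero; $B(x_k,u_k)$ is the block column $(G_{1,k+1},\ldots,G_{n,k+1})$; $C=[I_p\ 0\ \cdots\ 0]$. The coefficient matrices are, as the notation indicates, functions of $(x_k,u_k)$, defined on $\mathbb R^{np}\times\mathbb R^m$, and $y_k,u_k,x_k$ satisfy these relations. Set $f(x,u)=A(x,u)x+B(x,u)u$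 and $z_k=(x_k,u_k)$. Assumptions, for this $A,B$ (state dimension $np$): (A1) $A,B$ are continuously differentiable and there are $L_A,L_B\in(0,\infty)$ with $\|A(x,u)-A(\hat x,\hat u)\|\le L_A(\|x-\hat x\|+\|u-\hat u\|)$ and $\|B(x,u)-B(\hat x,\hat u)\|\le L_B(\|x-\hat x\|+\|u-\hat u\|)$ for all arguments. (A2) $A$ and $B$ are bounded in norm on the whole space. (A3) With $A_0=A(0,0)$, $B_0=B(0,0)$, $(A_0,B_0)$ is stabilizable and $(A_0,Q^{1/2})$ is detectable. Data: closed sets $\mathcal X\subseteq\mathbb R^{np}$, $\mathcal U\subseteq\mathbb R^m$ (described by finitely many affine equalities and inequalities); horizon $\ell\ge2$; symmetric $Q\in\mathbb R^{np\times np}$; symmetric positive definite $R\in\mathbb R^{m\times m}$. Terminal ingredients: $P$ is the unique (positive definite) stabilizing solution of $P=A_0^TPA_0-A_0^TPB_0(2R+B_0^TPB_0)^{-1}B_0^TPA_0+2Q$; $K_{\rm f}=-(2R+B_0^TPB_0)^{-1}B_0^TPA_0$; $\kappa_{\rm f}(x)=K_{\rm f}x$; $V_{\rm f}(x)=x^TPx$; $\mathcal X_{\rm f}=\{x:V_{\rm f}(x)\le\alpha\}$ with $\alpha>0$ such that (i) $\mathcal X_{\rm f}\subseteq\mathcal X$ and $\kappa_{\rm f}(\mathcal X_{\rm f})\subseteq\mathcal U$; (ii) $f(x,\kappa_{\rm f}(x))\in\mathcal X_{\rm f}$ for all $x\in\mathcal X_{\rm f}$; (iii) $V_{\rm f}(f(x,\kappa_{\rm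 f}(x)))-V_{\rm f}(x)\le-x^TQx-\kappa_{\rm f}(x)^TR\kappa_{\rm f}(x)$ for all $x\in\mathcal X_{\rm f}$. (Under the stated assumptions such an $\alpha$ exists.) ${\rm OCP}_k$: with $x_{k,1}=f(x_k,u_k)$, minimize over $U=(u_1,\ldots,u_{\ell-1})$ the cost $\bar J_k(U)=\tfrac12x_\ell^TPx_\ell+\tfrac12\sum_{j=1}^{\ell-1}(x_j^TQx_j+u_j^TRu_j)$, where $x_1=x_{k,1}$, $x_{j+1}=f(x_j,u_j)$, subject to $x_j\in\mathcal X$ ($1\le j\le\ell$), $u_j\in\mathcal U$ ($1\le j\le\ell-1$), $x_\ell\in\mathcal X_{\rm f}$. $U$ is feasible for ${\rm OCP}_k$ if it satisfies these constraints. $\mathcal F_\ell$ is the set of $(x,u)$ for which there exist $u_1,\ldots,u_{\ell-1}\in\mathcal U$ such that, with $x_1=f(x,u)$, $x_{j+1}=f(x_j,u_j)$, one has $x_j\in\mathcal X$ for $1\le j\le\ell-1$ and $x_\ell\in\mathcal X_{\rm f}$. For $U$ feasible for ${\rm OCP}_k$ with this trajectory, $\mathcal S_k(U)=(u_2,\ldots,u_{\ell-1},\kappa_{\rm f}(x_\ell))$. iSCD-MPC algorithm (maximum iteration number $\rho\ge1$, tolerance $\varepsilon>0$). At step $k$, set $x_{k,1}=f(x_k,u_k)$. A sequence $U_{k|i}=(u_{k,1|i},\ldots,u_{k,\ell-1|i})$ generates the rollout $x_{k,1|i}=x_{k,1}$, $x_{k,j+1|i}=f(x_{k,j|i},u_{k,j|i})$,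 with $A_{k,j|i}=A(x_{k,j|i},u_{k,j|i})$, $B_{k,j|i}=B(x_{k,j|i},u_{k,j|i})$. Initialization: $u_{0,j|1}=u_0$ for all $j$; warm start for $k\ge1$: $u_{k,j|1}=u_{k-1,j+1|\rho_{k-1}}$ for $j\le\ell-2$, $u_{k,\ell-1|1}=\kappa_{\rm f}(x_{k,\ell-1|1})$. For $i\ge2$, $U_{k|i}$ is the minimizer $(\mu_1,\ldots,\mu_{\ell-1})$ of $\tfrac12\xi_\ell^TP\xi_\ell+\tfrac12\sum_{j=1}^{\ell-1}(\xi_j^TQ\xi_j+\mu_j^TR\mu_j)$ subject to $\xi_1=x_{k,1}$, $\xi_{j+1}=A_{k,j|i-1}\xi_j+B_{k,j|i-1}\mu_j$, $\xi_j\in\mathcal X$ ($1\le j\le\ell$), $\mu_j\in\mathcal U$ ($1\le j\le\ell-1$). It stops at $\rho_k=\min\{\rho,\min\{i\in\{2,\ldots,\rho\}:\|U_{k|i}-U_{k|i-1}\|<\varepsilon\}\}$ (inner minimum equal to $\rho$ if the tolerance is never met), and the applied control is $u_{k+1}=u_{k,1|\rho_k}$. *)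

(* Defs.v *)
From HB Require Import structures.
From mathcomp Require Export all_boot all_order all_algebra.
From mathcomp Require Export all_classical all_reals all_analysis.
From mathcomp Require Export complex.

Set Implicit Arguments.
Unset Strict Implicit.
Unset Printing Implicit Defensive.

Export Order.TTheory GRing.Theory Num.Theory.
Export numFieldNormedType.Exports.

#[export] Set Implicit Arguments.
#[export] Unset Strict Implicit.
#[export] Unset Printing Implicit Defensive.

Local Open Scope classical_set_scope.
Local Open Scope ring_scope.

(* The library norm on matrices is the max norm, hence the next two
   definitions. *)
Definition enorm (R : realType) (n : nat) (v : 'cV[R]_n) : R :=
  Num.sqrt (\sum_(i < n) v i 0 ^+ 2).

Definition opnorm (R : realType) (m n : nat) (M : 'M[R]_(m, n)) : R :=
  sup [set enorm (M *m v) | v in [set v : 'cV[R]_n | enorm v <= 1]].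

Definition quad (R : realType) (n : nat) (M : 'M[R]_n) (v : 'cV[R]_n) : R :=
  (v^T *m M *m v) 0 0.

Definition symmetric_mx (R : realType) (n : nat) (M : 'M[R]_n) : Prop :=
  M^T = M.

Definition posdef (R : realType) (n : nat) (M : 'M[R]_n) : Prop :=
  symmetric_mx M /\ forall v : 'cV[R]_n, v != 0 -> 0 < quad M v.

Definition possemidef (R : realType) (n : nat) (M : 'M[R]_n) : Prop :=
  symmetric_mx M /\ forall v : 'cV[R]_n, 0 <= quad M v.

Definition is_sqrt_mx (R : realType) (n : nat) (M S : 'M[R]_n) : Prop :=
  possemidef S /\ S *m S = M.

(* Discrete-time stability: all complex eigenvalues in the open unit disc. *)
Definition schur (R : realType) (n : nat) (M : 'M[R]_n) : Prop :=
  forall z : R[i], eigenvalue (map_mx (real_complex R) M) z -> `|z| < 1.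

Definition stabilizable (R : realType) (n m : nat)
    (A : 'M[R]_n) (B : 'M[R]_(n, m)) : Prop :=
  exists K : 'M[R]_(m, n), schur (A + B *m K).

Definition detectable (R : realType) (n q : nat)
    (A : 'M[R]_n) (C : 'M[R]_(q, n)) : Prop :=
  exists L : 'M[R]_(n, q), schur (A + L *m C).

(* Frechet differentiable, with derivative continuous in operator norm. *)
Definition continuously_differentiable (R : realType)
    (V W : normedModType R) (F : V -> W) : Prop :=
  (forall z, differentiable F z) /\
  (forall z (e : R), 0 < e ->
     \forall z' \near z, forall v, `|'d F z' v - 'd F z v| <= e * `|v|).

Definition polyhedral (R : realType) (n : nat) (S : set 'cV[R]_n) : Prop :=
  exists (q r : nat) (H : 'M[R]_(q, n)) (h : 'cV[R]_q)
         (E : 'M[R]_(r, n)) (e : 'cV[R]_r),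
    S = [set x | (forall i, (H *m x) i 0 <= h i 0) /\ E *m x = e].

Definition lipschitz_xu (R : realType) (N m q r : nat)
    (F : 'cV[R]_N -> 'cV[R]_m -> 'M[R]_(q, r)) : Prop :=
  exists2 L : R, 0 < L & forall x x' u u',
    opnorm (F x u - F x' u') <= L * (enorm (x - x') + enorm (u - u')).

Definition bounded_xu (R : realType) (N m q r : nat)
    (F : 'cV[R]_N -> 'cV[R]_m -> 'M[R]_(q, r)) : Prop :=
  exists M : R, forall x u, opnorm (F x u) <= M.

Record mpc_data (R : realType) (N m : nat) := MpcData {
  Amap : 'cV[R]_N -> 'cV[R]_m -> 'M[R]_N;
  Bmap : 'cV[R]_N -> 'cV[R]_m -> 'M[R]_(N, m);
  Xset : set 'cV[R]_N;
  Uset : set 'cV[R]_m;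
  horizon : nat;
  Qmx : 'M[R]_N;
  Rmx : 'M[R]_m;
  Pmx : 'M[R]_N;
  level : R
}.

Definition A0 (R : realType) (N m : nat) (d : mpc_data R N m) := Amap d 0 0.
Definition B0 (R : realType) (N m : nat) (d : mpc_data R N m) := Bmap d 0 0.

Definition fstep (R : realType) (N m : nat) (d : mpc_data R N m)
    (x : 'cV[R]_N) (u : 'cV[R]_m) : 'cV[R]_N :=
  Amap d x u *m x + Bmap d x u *m u.

Definition assumption1 (R : realType) (N m : nat) (d : mpc_data R N m) : Prop :=
  [/\ continuously_differentiable
        (fun z : 'cV[R]_N * 'cV[R]_m => Amap d z.1 z.2),
      continuously_differentiable
        (fun z : 'cV[R]_N * 'cV[R]_m => Bmap d z.1 z.2),
      lipschitz_xu (Amap d) & lipschitz_xu (Bmap d)].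

Definition assumption2 (R : realType) (N m : nat) (d : mpc_data R N m) : Prop :=
  bounded_xu (Amap d) /\ bounded_xu (Bmap d).

Definition assumption3 (R : realType) (N m : nat) (d : mpc_data R N m) : Prop :=
  stabilizable (A0 d) (B0 d) /\
  exists2 S : 'M[R]_N, is_sqrt_mx (Qmx d) S & detectable (A0 d) S.

Definition gain_inv (R : realType) (N m : nat) (d : mpc_data R N m) : 'M[R]_m :=
  invmx (2%:R *: Rmx d + (B0 d)^T *m Pmx d *m B0 d).

Definition Kf (R : realType) (N m : nat) (d : mpc_data R N m) : 'M[R]_(m, N) :=
  - (gain_inv d *m (B0 d)^T *m Pmx d *m A0 d).

Definition kappaf (R : realType) (N m : nat) (d : mpc_data R N m)
    (x : 'cV[R]_N) : 'cV[R]_m := Kf d *m x.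

Definition Vf (R : realType) (N m : nat) (d : mpc_data R N m)
    (x : 'cV[R]_N) : R := quad (Pmx d) x.

Definition Xf (R : realType) (N m : nat) (d : mpc_data R N m) : set 'cV[R]_N :=
  [set x | Vf d x <= level d].

(* A stabilizing solution is one whose closed loop A0 + B0 Kf is Schur. *)
Definition stabilizing_dare (R : realType) (N m : nat) (d : mpc_data R N m)
    : Prop :=
  [/\ posdef (Pmx d),
      Pmx d = (A0 d)^T *m Pmx d *m A0 d
              - (A0 d)^T *m Pmx d *m B0 d *m gain_inv d
                *m (B0 d)^T *m Pmx d *m A0 d
              + 2%:R *: Qmx d
    & schur (A0 d + B0 d *m Kf d)].

Definition terminal_level (R : realType) (N m : nat) (d : mpc_data R N m)
    : Prop :=
  [/\ 0 < level d,
      Xf d `<=` Xset d /\ kappaf d @` Xf d `<=` Uset d,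
      forall x, Xf d x -> Xf d (fstep d x (kappaf d x))
    & forall x, Xf d x ->
        Vf d (fstep d x (kappaf d x)) - Vf d x
        <= - quad (Qmx d) x - quad (Rmx d) (kappaf d x)].

Definition mpc_setting (R : realType) (N m : nat) (d : mpc_data R N m)
    : Prop :=
  [/\ (closed (Xset d) /\ polyhedral (Xset d)) /\
      (closed (Uset d) /\ polyhedral (Uset d)),
      (2 <= horizon d)%N,
      symmetric_mx (Qmx d) /\ posdef (Rmx d),
      stabilizing_dare d
    & terminal_level d].

(* A control sequence (u_1, ..., u_(l-1)) is a function on nat of which only
   the values at 1, ..., l-1 matter. *)
Fixpoint rollout (R : realType) (N m : nat) (d : mpc_data R N m)
    (x1 : 'cV[R]_N) (U : nat -> 'cV[R]_m) (j : nat) : 'cV[R]_N :=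
  match j with
  | S ((S _) as i) => fstep d (rollout d x1 U i) (U i)
  | _ => x1
  end.

(* The trajectory of xi_(j+1) = A_j xi_j + B_j mu_j, with A_j and B_j frozen
   along the rollout of U. *)
Fixpoint frozen_rollout (R : realType) (N m : nat) (d : mpc_data R N m)
    (x1 : 'cV[R]_N) (U mu : nat -> 'cV[R]_m) (j : nat) : 'cV[R]_N :=
  match j with
  | S ((S _) as i) =>
      Amap d (rollout d x1 U i) (U i) *m frozen_rollout d x1 U mu i
      + Bmap d (rollout d x1 U i) (U i) *m mu i
  | _ => x1
  end.

Definition traj_cost (R : realType) (N m : nat) (d : mpc_data R N m)
    (x : nat -> 'cV[R]_N) (U : nat -> 'cV[R]_m) : R :=
  2^-1 * quad (Pmx d) (x (horizon d))
  + 2^-1 * \sum_(1 <= j < horizon d)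
             (quad (Qmx d) (x j) + quad (Rmx d) (U j)).

(* In the next definitions x1 stands for x_(k,1). *)
Definition Jbar (R : realType) (N m : nat) (d : mpc_data R N m)
    (x1 : 'cV[R]_N) (U : nat -> 'cV[R]_m) : R :=
  traj_cost d (rollout d x1 U) U.

Definition ocp_feasible (R : realType) (N m : nat) (d : mpc_data R N m)
    (x1 : 'cV[R]_N) (U : nat -> 'cV[R]_m) : Prop :=
  [/\ forall j, (1 <= j <= horizon d)%N -> Xset d (rollout d x1 U j),
      forall j, (1 <= j <= (horizon d).-1)%N -> Uset d (U j)
    & Xf d (rollout d x1 U (horizon d))].

Definition ocp_minimizer (R : realType) (N m : nat) (d : mpc_data R N m)
    (x1 : 'cV[R]_N) (U : nat -> 'cV[R]_m) : Prop :=
  ocp_feasible d x1 U /\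
  forall U', ocp_feasible d x1 U' -> Jbar d x1 U <= Jbar d x1 U'.

Definition Fell (R : realType) (N m : nat) (d : mpc_data R N m)
    : set ('cV[R]_N * 'cV[R]_m) :=
  [set z | exists U : nat -> 'cV[R]_m,
     [/\ forall j, (1 <= j <= (horizon d).-1)%N -> Uset d (U j),
         forall j, (1 <= j <= (horizon d).-1)%N ->
           Xset d (rollout d (fstep d z.1 z.2) U j)
       & Xf d (rollout d (fstep d z.1 z.2) U (horizon d))]].

Definition shifted (R : realType) (N m : nat) (d : mpc_data R N m)
    (x1 : 'cV[R]_N) (U : nat -> 'cV[R]_m) : nat -> 'cV[R]_m :=
  fun j => if (j < (horizon d).-1)%N then U j.+1
           else kappaf d (rollout d x1 U (horizon d)).

Definition qp_feasible (R : realType) (N m : nat) (d : mpc_data R N m)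
    (x1 : 'cV[R]_N) (U mu : nat -> 'cV[R]_m) : Prop :=
  (forall j, (1 <= j <= horizon d)%N -> Xset d (frozen_rollout d x1 U mu j)) /\
  (forall j, (1 <= j <= (horizon d).-1)%N -> Uset d (mu j)).

Definition qp_minimizer (R : realType) (N m : nat) (d : mpc_data R N m)
    (x1 : 'cV[R]_N) (U mu : nat -> 'cV[R]_m) : Prop :=
  qp_feasible d x1 U mu /\
  forall mu', qp_feasible d x1 U mu' ->
    traj_cost d (frozen_rollout d x1 U mu) mu
    <= traj_cost d (frozen_rollout d x1 U mu') mu'.

Definition seq_norm (R : realType) (N m : nat) (d : mpc_data R N m)
    (U : nat -> 'cV[R]_m) : R :=
  Num.sqrt (\sum_(1 <= j < horizon d) enorm (U j) ^+ 2).

(* U i is the i-th iterate U_(k|i). *)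
Definition stop_index (R : realType) (N m : nat) (d : mpc_data R N m)
    (rho : nat) (eps : R) (U : nat -> nat -> 'cV[R]_m) : nat :=
  \big[minn/rho]_(2 <= i < rho.+1
                  | seq_norm d (fun j => U i j - U i.-1 j) < eps) i.

(* U k i j is u_(k,j|i).  The subproblems are only required to be solved up to
   the iteration at which the algorithm stops; stop_index does not depend on
   the later values of U k. *)
Record iscd_mpc (R : realType) (N m : nat) (d : mpc_data R N m)
    (rho : nat) (eps : R) (x : nat -> 'cV[R]_N) (u : nat -> 'cV[R]_m)
    (U : nat -> nat -> nat -> 'cV[R]_m) : Prop := {
  iscd_init : forall j, (1 <= j <= (horizon d).-1)%N -> U 0%N 1%N j = u 0%N;
  iscd_warm : forall k j, (1 <= j <= (horizon d).-2)%N ->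
    U k.+1 1%N j = U k (stop_index d rho eps (U k)) j.+1;
  iscd_warm_last : forall k,
    U k.+1 1%N (horizon d).-1
    = kappaf d (rollout d (fstep d (x k.+1) (u k.+1)) (U k.+1 1%N)
                          (horizon d).-1);
  iscd_iter : forall k i, (2 <= i <= stop_index d rho eps (U k))%N ->
    qp_minimizer d (fstep d (x k) (u k)) (U k i.-1) (U k i);
  iscd_control : forall k,
    u k.+1 = U k (stop_index d rho eps (U k)) 1%N
}.

(* F_(tau,k) and G_(tau,k), for tau in {1, ..., n}; y and u are indexed by int
   so as to include the data at times -n, ..., -1. *)
Definition io_coef (R : realType) (n p m q : nat)
    (f : nat -> ('I_n -> 'cV[R]_p) -> ('I_n -> 'cV[R]_m) -> 'M[R]_(p, q))
    (y : int -> 'cV[R]_p) (u : int -> 'cV[R]_m) (tau : nat) (k : int)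
    : 'M[R]_(p, q) :=
  f tau (fun s : 'I_n => y (k - s.+1%:Z)) (fun s : 'I_n => u (k - s.+1%:Z)).

(* Phi tau x_k u_k and Gam tau x_k u_k are F_(tau,k+1) and G_(tau,k+1) as
   functions of the extended state; ordinals index blocks from 0, so that
   block i has tau = i.+1. *)
Definition bocfA (R : realType) (n p m : nat)
    (Phi : nat -> 'cV[R]_(\sum_(i < n) p) -> 'cV[R]_m -> 'M[R]_p)
    (x : 'cV[R]_(\sum_(i < n) p)) (u : 'cV[R]_m) : 'M[R]_(\sum_(i < n) p) :=
  \mxblock_(i < n, j < n)
    (if j == 0%N :> nat then - Phi i.+1 x u
     else if j == i.+1 :> nat then 1%:M else 0).

Definition bocfB (R : realType) (n p m : nat)
    (Gam : nat -> 'cV[R]_(\sum_(i < n) p) -> 'cV[R]_m -> 'M[R]_(p, m))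
    (x : 'cV[R]_(\sum_(i < n) p)) (u : 'cV[R]_m)
    : 'M[R]_(\sum_(i < n) p, m) :=
  \mxcol_(i < n) Gam i.+1 x u.

Definition bocfC (R : realType) (n p : nat) : 'M[R]_(p, \sum_(i < n) p) :=
  \mxrow_(j < n) (if j == 0%N :> nat then 1%:M else 0).

(* The equation at time 0 is not imposed: y_0 is part of the initial data. *)
Definition io_system (R : realType) (n p m : nat)
    (f : nat -> ('I_n -> 'cV[R]_p) -> ('I_n -> 'cV[R]_m) -> 'M[R]_p)
    (g : nat -> ('I_n -> 'cV[R]_p) -> ('I_n -> 'cV[R]_m) -> 'M[R]_(p, m))
    (y : int -> 'cV[R]_p) (u : int -> 'cV[R]_m) : Prop :=
  forall k : nat, (1 <= k)%N ->
    y k%:Z = - \sum_(1 <= tau < n.+1)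
                 (io_coef f y u tau k%:Z *m y (k%:Z - tau%:Z))
             + \sum_(1 <= tau < n.+1)
                 (io_coef g y u tau k%:Z *m u (k%:Z - tau%:Z)).

Definition bocf_state (R : realType) (n p m : nat)
    (f : nat -> ('I_n -> 'cV[R]_p) -> ('I_n -> 'cV[R]_m) -> 'M[R]_p)
    (g : nat -> ('I_n -> 'cV[R]_p) -> ('I_n -> 'cV[R]_m) -> 'M[R]_(p, m))
    (y : int -> 'cV[R]_p) (u : int -> 'cV[R]_m) (k : nat)
    : 'cV[R]_(\sum_(i < n) p) :=
  \mxcol_(i < n)
    (if i == 0%N :> nat then y k%:Z
     else \sum_(1 <= s < (n - i).+1)
            (- io_coef f y u (i + s)%N k%:Z *m y (k%:Z - s%:Z)
             + io_coef g y u (i + s)%N k%:Z *m u (k%:Z - s%:Z))).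

Record bocf_realization (R : realType) (n p m : nat)
    (f : nat -> ('I_n -> 'cV[R]_p) -> ('I_n -> 'cV[R]_m) -> 'M[R]_p)
    (g : nat -> ('I_n -> 'cV[R]_p) -> ('I_n -> 'cV[R]_m) -> 'M[R]_(p, m))
    (Phi : nat -> 'cV[R]_(\sum_(i < n) p) -> 'cV[R]_m -> 'M[R]_p)
    (Gam : nat -> 'cV[R]_(\sum_(i < n) p) -> 'cV[R]_m -> 'M[R]_(p, m))
    (y : int -> 'cV[R]_p) (u : int -> 'cV[R]_m)
    (x : nat -> 'cV[R]_(\sum_(i < n) p)) : Prop := {
  real_state : forall k, x k = bocf_state f g y u k;
  real_coefF : forall k tau, (1 <= tau <= n)%N ->
    io_coef f y u tau k.+1%:Z = Phi tau (x k) (u k%:Z);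
  real_coefG : forall k tau, (1 <= tau <= n)%N ->
    io_coef g y u tau k.+1%:Z = Gam tau (x k) (u k%:Z);
  real_step : forall k,
    x k.+1 = bocfA Phi (x k) (u k%:Z) *m x k
             + bocfB Gam (x k) (u k%:Z) *m u k%:Z;
  real_output : forall k, y k%:Z = bocfC R n p *m x k
}.

(* Main.v *)
Require Import Defs.
From mathcomp Require Import ring lra.

(** The proof is the standard Lyapunov argument of model predictive control, with
    the optimal or suboptimal cost as Lyapunov function.  Let [J k] be the cost of
    the sequence applied at step [k].  Dropping the first control of a feasible
    sequence and appending the terminal feedback gives a sequence for step [k.+1]
    that is again feasible ([shifted_feasible]) and, because the terminal penalty
    decreases along the terminal feedback at least as fast as the stage cost
    accumulates, whose cost is at most [J k] minus half of
    [quad Q (x k.+1)] ([Jbar_shifted]).  The sequence applied at step [k.+1] costs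
    no more than this shift: in part (a) because it is a minimizer and the shift is
    feasible, in part (b) by hypothesis.  Hence [J] is nonnegative and decreases by
    at least half of [quad Q (x k.+1)] at each step, which forces the latter to
    tend to 0 ([decrease_cvg0]).

    Since [Q] is positive definite, every linear image of the state, in particular
    the output [y = C x], tends to 0 as well ([quad_cvg0]); the Cauchy-Schwarz
    inequality for the form of [Q] gives the required bound without spectral theory
    or compactness. *)

Local Open Scope classical_set_scope.
Local Open Scope ring_scope.

(** * Positive definite quadratic forms *)

Lemma quad_ge0 (R : realType) n (M : 'M[R]_n) v : posdef M -> 0 <= quad M v.
Proof.
move=> [_ M_gt0]; have [->|/M_gt0/ltW//] := eqVneq v 0.
by rewrite /quad mulmx0 mxE.
Qed.

Lemma posdef_unitmx (R : realType) n (M : 'M[R]_n) : posdef M -> M \in unitmx.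
Proof.
move=> [Msym M_gt0]; rewrite -row_free_unit -kermx_eq0.
apply/eqP/row_matrixP => i; rewrite row0; apply/eqP/negPn/negP => ki_neq0.
have /M_gt0 : (row i (kermx M))^T != 0.
  by apply: contra ki_neq0 => /eqP k0; rewrite -[row _ _]trmxK k0 trmx0.
by rewrite /quad trmxK -row_mul mulmx_ker row0 mul0mx mxE ltxx.
Qed.

(** Expand the nonnegative value of the quadratic form at
    [quad M a *: v - b *: a], where [b] is the bilinear form at [a] and [v]; it
    equals [quad M a * (quad M a * quad M v - b ^+ 2)]. *)
Lemma quad_cauchy_schwarz (R : realType) n (M : 'M[R]_n) a v : posdef M ->
  (a^T *m M *m v) 0 0 ^+ 2 <= quad M a * quad M v.
Proof.
move=> Mpos; have [Msym M_gt0] := Mpos.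
have [->|a_neq0] := eqVneq a 0.
  by rewrite /quad trmx0 !mul0mx !mxE expr0n mul0r.
have qa_gt0 := M_gt0 _ a_neq0.
set b := (a^T *m M *m v) 0 0.
have bC : (v^T *m M *m a) 0 0 = b.
  rewrite /b -[a^T *m M *m v]trmxK [RHS]mxE.
  by rewrite !trmx_mul trmxK Msym mulmxA.
have := quad_ge0 (quad M a *: v - b *: a) Mpos.
have -> : quad M (quad M a *: v - b *: a)
          = quad M a * (quad M a * quad M v - b ^+ 2).
  rewrite {1}/quad mulmxBr -!scalemxAr [(_ - _)^T]raddfB /=.
  rewrite ![(_ *: _)^T]linearZ /= !mulmxBl -!scalemxAl.
  move: bC; rewrite /b /quad.
  move: (v^T *m M *m a) (a^T *m M *m v) => vMa aMv.
  move: (a^T *m M *m a) (v^T *m M *m v) => aMa vMv.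
  by move=> vMaC; rewrite !mxE vMaC; ring.
by rewrite pmulr_rge0// subr_ge0.
Qed.

(** Cauchy-Schwarz for the form of [M], applied to the vector
    [invmx M *m (row i C)^T] that represents the linear functional [row i C] in
    this inner product.  This replaces
    the usual lower bound by the smallest eigenvalue of [M]. *)
Lemma posdef_dominates_coord (R : realType) n p (M : 'M[R]_n)
    (C : 'M[R]_(p, n)) i :
  posdef M -> exists c, forall v, (C *m v) i 0 ^+ 2 <= c * quad M v.
Proof.
move=> Mpos; exists (quad M (invmx M *m (row i C)^T)) => v.
have [Msym _] := Mpos.
suff -> : (C *m v) i 0 = ((invmx M *m (row i C)^T)^T *m M *m v) 0 0.
  exact: quad_cauchy_schwarz.
rewrite trmx_mul trmxK trmx_inv Msym mulmxKV ?posdef_unitmx//.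
by rewrite -row_mul [RHS]mxE.
Qed.

Lemma quad_cvg0 (R : realType) n p (M : 'M[R]_n) (C : 'M[R]_(p, n))
    (x : nat -> 'cV[R]_n) : posdef M ->
  (fun k => quad M (x k)) @ \oo --> (0 : R) ->
  (fun k => C *m x k) @ \oo --> (0 : 'cV[R]_p).
Proof.
move=> Mpos q0; apply/cvgr0Pnorm_lt => e e_gt0.
suff: \forall k \near \oo, forall i, `|(C *m x k) i 0| < e.
  apply: filterS => k Cxk_lt; rewrite [`|_|]mx_normrE.
  by apply: bigmax_lt => // -[i j] _ /=; rewrite ord1.
apply: filter_forall => i.
have [c c_ge] := posdef_dominates_coord C i Mpos.
have cq0 : (fun k => c * quad M (x k)) @ \oo --> (0 : R).
  by rewrite -(mulr0 c); apply: (cvgM (cvg_cst c) q0).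
have e2_gt0 : 0 < e ^+ 2 by rewrite exprn_gt0.
have : \forall k \near \oo, c * quad M (x k) < e ^+ 2.
  exact: cvgr_lt cq0 _ e2_gt0.
apply: filterS => k /(le_lt_trans (c_ge (x k))).
by rewrite -real_normK ?num_real// ltr_pXn2r// ?nnegrE// ltW.
Qed.

(** [J] is nonincreasing and bounded below, hence convergent, and [q] is squeezed
    between zero and the consecutive differences of [J]. *)
Lemma decrease_cvg0 (R : realType) (J q : nat -> R) :
  (forall k, 0 <= J k) -> (forall k, 0 <= q k) ->
  (forall k, J k.+1 <= J k - q k) -> q @ \oo --> (0 : R).
Proof.
move=> J_ge0 q_ge0 Jdec.
have /cvg_ex [l Jl] : cvgn J.
  apply: nonincreasing_is_cvgn.
    by apply/nonincreasing_seqP => k; have := Jdec k; have := q_ge0 k; lra.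
  by exists 0 => _ [k _ <-].
have JSl : (fun k => J k.+1) @ \oo --> l by rewrite cvg_shiftS.
have J0 : (fun k => J k - J k.+1) @ \oo --> (0 : R).
  by rewrite -[X in _ --> X](subrr l); apply: cvgB.
apply: (@squeeze_cvgr _ _ _ _ (fun=> 0) (fun k => J k - J k.+1)) J0.
- by apply: nearW => k; rewrite q_ge0 /=; have := Jdec k; lra.
- exact: cvg_cst.
Qed.

(** * The shifted control sequence *)

Lemma rolloutSS (R : realType) (N m : nat) (d : mpc_data R N m)
    (x : 'cV[R]_N) (U : nat -> 'cV[R]_m) j :
  rollout d x U j.+2 = fstep d (rollout d x U j.+1) (U j.+1).
Proof. by []. Qed.

(** State [j] depends only on the controls before [j], and the shifted controls
    coincide with [U] advanced by one step except at the last index, where the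
    terminal feedback acts; hence the bound [j < horizon d]. *)
Lemma rollout_shifted (R : realType) (N m : nat) (d : mpc_data R N m)
    (x : 'cV[R]_N) (U : nat -> 'cV[R]_m) j : (1 <= j < horizon d)%N ->
  rollout d (fstep d x (U 1%N)) (shifted d x U) j = rollout d x U j.+1.
Proof.
case: j => // j; rewrite andTb; elim: j => [//|j IHj] jl.
rewrite rolloutSS IHj 1?ltnW// (rolloutSS d x U j.+1) /shifted.
by rewrite ifT// ltn_predRL.
Qed.

Lemma shifted_last (R : realType) (N m : nat) (d : mpc_data R N m)
    (x : 'cV[R]_N) (U : nat -> 'cV[R]_m) :
  shifted d x U (horizon d).-1 = kappaf d (rollout d x U (horizon d)).
Proof. by rewrite /shifted ltnn. Qed.

Lemma rollout_shifted_horizon (R : realType) (N m : nat) (d : mpc_data R N m)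
    (x : 'cV[R]_N) (U : nat -> 'cV[R]_m) (xl := rollout d x U (horizon d)) :
  (2 <= horizon d)%N ->
  rollout d (fstep d x (U 1%N)) (shifted d x U) (horizon d)
  = fstep d xl (kappaf d xl).
Proof.
move=> l_ge2; rewrite /xl -shifted_last.
move: l_ge2 (@rollout_shifted _ _ _ d x U (horizon d).-1).
by case: (horizon d) => [|[|l]]//= _ ->.
Qed.

(** Recursive feasibility: the only new state of the shifted trajectory is the
    successor of the old terminal state under the terminal feedback, and the
    terminal set is admissible and invariant under that feedback. *)
Lemma shifted_feasible (R : realType) (N m : nat) (d : mpc_data R N m)
    (x : 'cV[R]_N) (U : nat -> 'cV[R]_m) :
  (2 <= horizon d)%N ->
  terminal_level d -> ocp_feasible d x U ->
  ocp_feasible d (fstep d x (U 1%N)) (shifted d x U).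
Proof.
move=> l_ge2 [_ [XfX kXf] invXf _] [Xx UU Xl]; have l_gt0 := ltnW l_ge2.
split=> [j /andP[j1]|j /andP[j1 jl]|].
- rewrite leq_eqVlt => /predU1P[->|jl].
    by rewrite rollout_shifted_horizon//; exact/XfX/invXf.
  by rewrite rollout_shifted ?j1//; apply: Xx.
- rewrite /shifted; case: ifP => [jl'|_]; first exact: UU.
  by apply: kXf; exists (rollout d x U (horizon d)).
- by rewrite rollout_shifted_horizon//; exact: invXf.
Qed.

(** Shifting drops the first stage cost, appends the stage cost of the terminal
    feedback at the old terminal state, and moves the terminal penalty one step
    ahead.  The terminal decrease condition says that the last two changes add
    up to at most zero, so what is saved is the first stage cost, of which only
    the state part is retained. *)
Lemma Jbar_shifted (R : realType) (N m : nat) (d : mpc_data R N m)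
    (x : 'cV[R]_N) (U : nat -> 'cV[R]_m) :
  (2 <= horizon d)%N ->
  terminal_level d -> posdef (Rmx d) -> Xf d (rollout d x U (horizon d)) ->
  Jbar d (fstep d x (U 1%N)) (shifted d x U)
  <= Jbar d x U - 2^-1 * quad (Qmx d) x.
Proof.
move=> l_ge2 [_ _ _ decr] Rpos Xl.
rewrite /Jbar /traj_cost rollout_shifted_horizon//.
have := decr _ Xl; rewrite /Vf; set xl := rollout d x U (horizon d) => decr_xl.
set stage := fun j => quad (Qmx d) (rollout d x U j) + quad (Rmx d) (U j).
set shifted_stage := fun j =>
  quad (Qmx d) (rollout d (fstep d x (U 1%N)) (shifted d x U) j)
  + quad (Rmx d) (shifted d x U j).
have last_gt0 : (1 <= (horizon d).-1)%N by rewrite -ltnS prednK// ltnW.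
have -> : \sum_(1 <= j < horizon d) stage j
          = stage 1%N + \sum_(1 <= j < (horizon d).-1) stage j.+1.
  by rewrite big_ltn// big_add1.
have -> : \sum_(1 <= j < horizon d) shifted_stage j
          = \sum_(1 <= j < (horizon d).-1) stage j.+1
            + (quad (Qmx d) xl + quad (Rmx d) (kappaf d xl)).
  rewrite -{1}(prednK (ltnW l_ge2)) big_nat_recr//=; congr (_ + _).
    apply: eq_big_nat => j /andP[j1 jl]; rewrite /shifted_stage /stage.
    rewrite rollout_shifted; last by rewrite j1 (leq_trans jl)// leq_pred.
    by rewrite /shifted jl.
  rewrite /shifted_stage shifted_last rollout_shifted ?prednK ?(ltnW l_ge2)//.
  by rewrite last_gt0 leqnn.
have := quad_ge0 (U 1%N) Rpos; rewrite /stage /=.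
by move: (\sum_(_ <= _ < _) _) => S; lra.
Qed.

Lemma Jbar_ge0 (R : realType) (N m : nat) (d : mpc_data R N m)
    (x : 'cV[R]_N) (U : nat -> 'cV[R]_m) :
  posdef (Pmx d) -> posdef (Qmx d) -> posdef (Rmx d) ->
  0 <= Jbar d x U.
Proof.
move=> Ppos Qpos Rpos; rewrite /Jbar /traj_cost addr_ge0// mulr_ge0 ?quad_ge0//.
by apply: sumr_ge0 => j _; rewrite addr_ge0 ?quad_ge0.
Qed.

(** * Convergence of the closed loop *)

(** Common core of the optimal and of the inexact scheme: optimality enters only
    through the fact that each applied sequence costs no more than the shift of
    its predecessor.  The rollout that is optimized at step [k] starts at
    [x k.+1], and the next one starts at [fstep d (x k.+1) (V k 1)], which is
    where the shifted sequence starts. *)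
Lemma suboptimal_mpc_output_cvg0 (R : realType) (N m p : nat)
    (d : mpc_data R N m)
    (C : 'M[R]_(p, N)) (x : nat -> 'cV[R]_N) (u : nat -> 'cV[R]_m)
    (V : nat -> nat -> 'cV[R]_m) :
  mpc_setting d -> posdef (Qmx d) ->
  (forall k, x k.+1 = fstep d (x k) (u k)) -> (forall k, u k.+1 = V k 1%N) ->
  (forall k, ocp_feasible d (x k.+1) (V k)) ->
  (forall k, Jbar d (x k.+2) (V k.+1)
             <= Jbar d (x k.+2) (shifted d (x k.+1) (V k))) ->
  (fun k => C *m x k) @ \oo --> (0 : 'cV[R]_p).
Proof.
move=> [_ l_ge2 [_ Rpos] [Ppos _ _] term] Qpos xS uS Vfeas Jle.
apply: (quad_cvg0 _ Qpos); rewrite -cvg_shiftS.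
(* The factor 2 cancels the halves in the cost. *)
apply: (@decrease_cvg0 _ (fun k => 2 * Jbar d (x k.+1) (V k))) => k.
- by rewrite mulr_ge0 ?Jbar_ge0.
- exact: quad_ge0.
- have [_ _ Xl] := Vfeas k.
  have := Jbar_shifted l_ge2 term Rpos Xl.
  by rewrite -uS -xS => /(le_trans (Jle k)) /=; lra.
Qed.

Theorem proposition9 (R : realType) (n p m : nat)
    (n_gt0 : (0 < n)%N) (p_gt0 : (0 < p)%N) (m_gt0 : (0 < m)%N)
    (f : nat -> ('I_n -> 'cV[R]_p) -> ('I_n -> 'cV[R]_m) -> 'M[R]_p)
    (g : nat -> ('I_n -> 'cV[R]_p) -> ('I_n -> 'cV[R]_m) -> 'M[R]_(p, m))
    (Phi : nat -> 'cV[R]_(\sum_(i < n) p) -> 'cV[R]_m -> 'M[R]_p)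
    (Gam : nat -> 'cV[R]_(\sum_(i < n) p) -> 'cV[R]_m -> 'M[R]_(p, m))
    (X : set 'cV[R]_(\sum_(i < n) p)) (U : set 'cV[R]_m) (l : nat)
    (Q : 'M[R]_(\sum_(i < n) p)) (Rw : 'M[R]_m)
    (P : 'M[R]_(\sum_(i < n) p)) (alpha : R) :
  let d := MpcData (bocfA Phi) (bocfB Gam) X U l Q Rw P alpha in
  mpc_setting d ->
  (* (a) *)
  (assumption1 d -> assumption2 d -> assumption3 d -> posdef Q ->
   interior X 0 -> interior U 0 ->
   forall (y : int -> 'cV[R]_p) (u : int -> 'cV[R]_m)
          (x : nat -> 'cV[R]_(\sum_(i < n) p)),
     io_system f g y u ->
     bocf_realization f g Phi Gam y u x ->
     (forall k : nat, exists2 V : nat -> 'cV[R]_m,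
        ocp_minimizer d (fstep d (x k) (u k%:Z)) V & u k.+1%:Z = V 1%N) ->
     Fell d (x 0%N, u 0) ->
     (fun k : nat => y k%:Z) @ \oo --> (0 : 'cV[R]_p))
  /\
  (* (b) *)
  (assumption1 d -> assumption2 d -> assumption3 d -> posdef Q ->
   interior X 0 -> interior U 0 ->
   forall (rho : nat) (eps : R), (1 <= rho)%N -> 0 < eps ->
   forall (y : int -> 'cV[R]_p) (u : int -> 'cV[R]_m)
          (x : nat -> 'cV[R]_(\sum_(i < n) p))
          (V : nat -> nat -> nat -> 'cV[R]_m),
     io_system f g y u ->
     bocf_realization f g Phi Gam y u x ->
     iscd_mpc d rho eps x (fun k : nat => u k%:Z) V ->
     let applied k := V k (stop_index d rho eps (V k)) in
     (forall k : nat, ocp_feasible d (fstep d (x k) (u k%:Z)) (applied k)) ->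
     (forall k : nat, (1 <= k)%N ->
        Jbar d (fstep d (x k) (u k%:Z)) (applied k)
        <= Jbar d (fstep d (x k) (u k%:Z))
             (shifted d (fstep d (x k.-1) (u k.-1%:Z)) (applied k.-1))) ->
     Fell d (x 0%N, u 0) ->
     ocp_feasible d (fstep d (x 0%N) (u 0)) (applied 0%N) ->
     (fun k : nat => y k%:Z) @ \oo --> (0 : 'cV[R]_p)).
Proof.
move=> d setting; have [_ l_ge2 _ _ term] := setting.
split=> [_ _ _ Qpos _ _ y u x _ real opt _
       |_ _ _ Qpos _ _ rho eps _ _ y u x V _ real alg applied feas Jle _ _].
- have xS k : x k.+1 = fstep d (x k) (u k%:Z) by exact: (real_step real).
  have [V Vopt] := choice (fun k => let: ex_intro2 V h1 h2 := opt k in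
    ex_intro (fun V => ocp_minimizer d (fstep d (x k) (u k%:Z)) V
                       /\ u k.+1%:Z = V 1%N) V (conj h1 h2)).
  rewrite (funext (real_output real)).
  apply: (@suboptimal_mpc_output_cvg0 _ _ _ _ d _ _ (fun k => u k%:Z) V) => // k.
  + by have [] := Vopt k.
  + by rewrite xS; have [[]] := Vopt k.
  (* Optimality at step k.+1 is tested against the shift of V k. *)
  + have [[feas _] uS] := Vopt k; have [[_ opt1] _] := Vopt k.+1.
    rewrite (xS k.+1); apply: opt1; rewrite uS xS.
    exact: shifted_feasible.
- have xS k : x k.+1 = fstep d (x k) (u k%:Z) by exact: (real_step real).
  rewrite (funext (real_output real)).
  apply: (@suboptimal_mpc_output_cvg0 _ _ _ _ d _ _ (fun k => u k%:Z) applied) => // k.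
  + exact: (iscd_control alg).
  + by rewrite xS; exact: feas.
  + by rewrite (xS k.+1) {3}(xS k); exact: (Jle k.+1).
Qed.
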